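(* For all integers $n > 2$, $$o3(n+2) + o3(n-1) = c(n),$$ where $o3(m)$ denotes the number of partitions of $m$ in which no odd part is repeated, the largest part is even, and the largest part appears exactly once, and $c(m)$ denotes the number of partitions of $m$ in which no part is congruent to $2$ modulo $4$.
   Context: A partition of a non-negative integer $m$ is a non-increasing sequence of positive integers $\lambda_1 \ge \lambda_2 \ge \cdots \ge \lambda_k$ (the parts) with $\sum_{i=1}^k \lambda_i = m$. Let $\text{O1}(m)$ be the set of partitions of $m$ in which every odd part occurs at most once (even parts may be repeated) and the largest part is even. Let $\text{O3}(m)$ be the subset of $\text{O1}(m)$ consisting of the partitions whose largest part appears exactly once; $o3(m) = |\text{O3}(m)|$. Let $\text{C}(m)$ be the set of partitions of $m$ having no part congruent to $2$ modulo $4$; $c(m) = |\text{C}(m)|$. *)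

(* Defs.v *)
From mathcomp Require Import all_boot.

Set Implicit Arguments.
Unset Strict Implicit.
Unset Printing Implicit Defensive.

Definition is_partition (m : nat) (s : seq nat) : bool :=
  [&& sorted geq s, all (fun p => 0 < p) s & sumn s == m].

(* A partition of m has at most m parts, all of them at most m, so partitions
   of m are exactly the [parts l] with [l] in the finite type below and
   [is_partition m (parts l)]; see [bounded_of_partition]. *)
Definition bounded (m : nat) : finType := (m.-bseq 'I_m.+1)%type.

Definition parts (m : nat) (l : bounded m) : seq nat :=
  [seq val i | i <- bseqval l].

Lemma parts_inj (m : nat) : injective (@parts m).
Proof. by move=> l1 l2 /(inj_map val_inj) /val_inj. Qed.

Lemma bounded_of_partition (m : nat) (s : seq nat) :
  is_partition m s -> exists l : bounded m, parts l = s.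
Proof.
case/and3P=> _ s_gt0 /eqP sum_s.
have s_le p : p \in s -> p < m.+1.
  rewrite ltnS -sum_s; elim: s {s_gt0 sum_s} => //= a s IHs.
  rewrite inE => /predU1P[-> | /IHs]; first exact: leq_addr.
  by move/leq_trans; apply; apply: leq_addl.
have size_s : size s <= m.
  rewrite -sum_s; elim: s s_gt0 {sum_s s_le} => //= a s IHs /andP[a_gt0 s_gt0].
  by rewrite -add1n leq_add // IHs.
have size_l : size [seq (inord p : 'I_m.+1) | p <- s] <= m by rewrite size_map.
exists (Bseq size_l); rewrite /parts /= -map_comp.
by apply: map_id_in => p /s_le lt_p_m /=; rewrite inordK.
Qed.

Definition partitions (m : nat) : {set bounded m} :=
  [set l | is_partition m (parts l)].

(* Partitions are non-increasing, so the largest part comes first; it is 0 for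
   the empty partition, by convention. *)
Definition largest (s : seq nat) : nat := head 0 s.

Definition O1 (m : nat) : {set bounded m} :=
  [set l in partitions m |
     all (fun p => odd p ==> (count_mem p (parts l) <= 1)) (parts l)
     && ~~ odd (largest (parts l))].

Definition O3 (m : nat) : {set bounded m} :=
  [set l in O1 m | count_mem (largest (parts l)) (parts l) == 1].

Definition o3 (m : nat) : nat := #|O3 m|.

Definition C (m : nat) : {set bounded m} :=
  [set l in partitions m | all (fun p => p != 2 %[mod 4]) (parts l)].

Definition c (m : nat) : nat := #|C m|.

(* Main.v *)
Require Import Defs.
From mathcomp Require Import all_boot all_algebra zify ring.

(* Sorting the partitions counted by o3 according to their largest part 2k gives
     sum_m o3(m) x^m = sum_(k >= 1) x^(2k) D_k,
     D_k = prod_(odd p < 2k) (1 + x^p) / prod_(even 0 < p < 2k) (1 - x^p).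
   Multiplied by 1 + x^3, the partial sums telescope:
     (1 + x^3) sum_(1 <= j <= k) x^(2j) D_j = x^2 D_k (1 + x^(2k+1)),
   which tends to x^2 prod_(p odd) (1 + x^p) / prod_(p even) (1 - x^p).  Writing
   1 / (1 - x^p) = (1 + x^p) / (1 - x^(2p)) for p odd turns this limit into
   x^2 times the generating function of c, and one compares the coefficients
   of x^(n+2).  Power series are replaced by elements of Z[X]/(X^N), N large. *)

Set Implicit Arguments.
Unset Strict Implicit.
Unset Printing Implicit Defensive.
Import GRing.Theory.

(** * Bounds on parts and multiplicities *)

Lemma sumn_count_mem (N : nat) (s : seq nat) :
  all (fun p => p < N) s -> sumn s = \sum_(p < N) p * count_mem (p : nat) s.
Proof.
elim: s => [_ | a s IHs /= /andP[a_lt /IHs->]].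
  by rewrite big1 // => p _; rewrite muln0.
rewrite (eq_bigr (fun p : 'I_N => p * (a == p) + p * count_mem (p : nat) s)).
  rewrite big_split /= [in RHS](bigD1 (Ordinal a_lt)) //= eqxx muln1.
  rewrite [X in _ + X + _]big1 ?addn0 //.
  by move=> p; rewrite -val_eqE /= eq_sym => /negPf->; rewrite muln0.
by move=> p _; rewrite mulnDr.
Qed.

Lemma partition_parts_lt (m N : nat) (s : seq nat) :
  is_partition m s -> m < N -> all (fun p => p < N) s.
Proof.
case/and3P=> _ _ /eqP <- {m}; elim: s N => //= a s IHs N ltN.
by rewrite IHs; lia.
Qed.

Lemma partition_count_le (m p : nat) (s : seq nat) :
  is_partition m s -> count_mem p s <= m.
Proof.
case/and3P=> _ s_gt0 /eqP <- {m}; elim: s s_gt0 => //= a s IHs /andP[a_gt0 /IHs].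
by case: (a == p) => /=; lia.
Qed.

Lemma partition_count0 (m : nat) (s : seq nat) :
  is_partition m s -> count_mem 0 s = 0.
Proof.
case/and3P=> _ s_gt0 _; apply/count_memPn.
by apply/negP => /(allP s_gt0).
Qed.

(** * Partitions with constrained multiplicities *)

Section Multiplicities.

Variables (mu : nat -> pred nat) (m N : nat).
Hypotheses (mu0 : forall i, mu 0 i = (i == 0)) (m_lt : m < N).

(** [mu p i] tells whether [p] may occur [i] times. Testing only [p < N] loses nothing for
    partitions of [m < N], whose parts all lie below [N]. *)
Definition respects (s : seq nat) : bool :=
  [forall p : 'I_N, mu p (count_mem (p : nat) s)].

Lemma partition_of_multiplicities (f : {ffun 'I_N -> 'I_N}) :
  (forall p : 'I_N, mu p (f p)) -> \sum_(p < N) p * f p = m ->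
  exists2 s, is_partition m s & forall p : 'I_N, count_mem (p : nat) s = f p.
Proof.
move=> f_mu f_sum.
pose s := sort geq (flatten [seq nseq (f p) (p : nat) | p <- enum 'I_N]).
have s_count (p : 'I_N) : count_mem (p : nat) s = f p.
  rewrite /s count_sort count_flatten -map_comp sumnE big_map big_enum /=.
  rewrite (bigD1 p) //= count_nseq /= eqxx mul1n big1 ?addn0 // => q.
  by rewrite -val_eqE count_nseq /= => /negPf->.
have s_lt : all (fun p => p < N) s.
  rewrite all_sort; apply/allP=> x /flatten_mapP[p _ /nseqP[-> _]]; exact: ltn_ord.
exists s => //; apply/and3P; split.
- by apply: sort_sorted => x y; exact: leq_total.
- apply/allP=> p s_p; rewrite lt0n; apply/negP=> /eqP p0.
  have N_gt0 : 0 < N by apply: leq_ltn_trans m_lt.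
  move: s_p (f_mu (Ordinal N_gt0)); rewrite p0 mu0 -s_count /= => s_0 /eqP /count_memPn.
  by rewrite s_0.
- apply/eqP; rewrite (sumn_count_mem s_lt) -f_sum.
  by apply: eq_bigr => p _; rewrite s_count.
Qed.

(** A partition is determined by its multiplicities, each of which is at most [m < N] and so fits in
    ['I_N]. *)
Lemma card_partitions_respecting :
  #|[set l in partitions m | respects (parts l)]| =
  #|[set f : {ffun 'I_N -> 'I_N} |
      [forall p : 'I_N, mu p (f p)] && (\sum_(p < N) p * f p == m)]|.
Proof.
have N_gt0 : 0 < N by apply: leq_ltn_trans m_lt.
pose F (l : bounded m) : {ffun 'I_N -> 'I_N} :=
  [ffun p : 'I_N => insubd (Ordinal N_gt0) (count_mem (p : nat) (parts l))].
have FE l p : is_partition m (parts l) -> F l p = count_mem (p : nat) (parts l) :> nat.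
  move=> l_part; rewrite ffunE [LHS]insubdK //.
  exact: leq_ltn_trans (partition_count_le p l_part) m_lt.
rewrite -(card_in_imset (f := F)); last first.
  move=> l1 l2; rewrite !inE => /andP[l1_part _] /andP[l2_part _] /ffunP eqF.
  apply: parts_inj.
  have [/and3P[l1_sorted _ _] /and3P[l2_sorted _ _]] := (l1_part, l2_part).
  apply: (sorted_eq (leT := geq)) => //.
  - by move=> y x z /= yx zy; apply: leq_trans yx.
  - by move=> x y /= le_xy; apply/eqP; rewrite eqn_leq andbC.
  apply/allP=> p p_in /=.
  have p_lt : p < N.
    have := partition_parts_lt l1_part m_lt; have := partition_parts_lt l2_part m_lt.
    by move: p_in; rewrite mem_cat => /orP[] p_in /allP ? /allP ?; auto.
  by rewrite -(FE _ (Ordinal p_lt)) // -[X in _ == X](FE _ (Ordinal p_lt)) // eqF.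
apply: eq_card => f; rewrite !inE; apply/imsetP/andP => [[l]|[/forallP f_mu /eqP f_sum]].
  rewrite !inE => /andP[l_part /forallP l_mu] ->; split.
    by apply/forallP=> p; rewrite FE.
  have [_ _ /eqP <-] := and3P l_part.
  rewrite (sumn_count_mem (partition_parts_lt l_part m_lt)).
  by apply/eqP; apply: eq_bigr => p _; rewrite FE.
have [s s_part s_count] := partition_of_multiplicities f_mu f_sum.
have [l l_s] := bounded_of_partition s_part.
exists l; first by rewrite !inE l_s s_part; apply/forallP => p; rewrite s_count.
by apply/ffunP=> p; apply: val_inj; rewrite [RHS]FE l_s ?s_count.
Qed.

(** Expanding the product chooses a multiplicity [f p] for every [p]; the resulting monomial has as
    exponent the sum of all [p * f p]. *)
Lemma coef_prod_multiplicities :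
  ((\prod_(p < N) \sum_(i < N | mu p i) 'X^(p * i) : {poly int})`_m =
   #|[set l in partitions m | respects (parts l)]|%:R)%R.
Proof.
rewrite card_partitions_respecting bigA_distr_big_dep coef_sum.
under eq_bigr do rewrite prodrXr coefXn.
rewrite -natr_sum -sum1_card; congr _%:R%R.
rewrite [LHS]big_mkcond [RHS]big_mkcond; apply: eq_bigr => f _ /=.
have -> : (f \in family (fun p : 'I_N => [pred i : 'I_N | mu p i])) =
    [forall p : 'I_N, mu p (f p)] by [].
by rewrite inE [m == _]eq_sym; case: [forall p, _] => //=; case: eqP.
Qed.
End Multiplicities.

(** * Series in a nilpotent element *)

Section TruncatedSeries.
Local Open Scope ring_scope.

Variables (A : comNzRingType) (x : A) (N : nat).
Hypothesis xN : x ^+ N = 0.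

(* The inverse of 1 - x^p for p > 0; geom 0 has the junk value N. *)
Definition geom (p : nat) : A := \sum_(i < N) x ^+ (p * i).

Lemma exprN_ge n : (N <= n)%N -> x ^+ n = 0.
Proof. by move/subnK <-; rewrite exprD xN mulr0. Qed.

(** The product telescopes to [1 - x ^+ (p * N)], whose power of [x] vanishes as [N <= p * N]. *)
Lemma geomK p : (0 < p)%N -> (1 - x ^+ p) * geom p = 1.
Proof.
move=> p_gt0; rewrite /geom; under eq_bigr do rewrite exprM.
rewrite -[LHS]opprK -mulNr opprB -subrX1 -exprM exprN_ge ?sub0r ?opprK //.
exact: leq_pmull.
Qed.

Lemma geom_double p : (0 < p)%N -> geom p = (1 + x ^+ p) * geom (2 * p).
Proof.
move=> p_gt0; have h1 := geomK p_gt0.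
have h2 : (1 - x ^+ (2 * p)) * geom (2 * p) = 1 by apply: geomK; lia.
rewrite mulnC exprM -mulnC in h2.
transitivity (geom p * ((1 - (x ^+ p) ^+ 2) * geom (2 * p))).
  by rewrite h2 mulr1.
transitivity ((1 + x ^+ p) * geom (2 * p) * ((1 - x ^+ p) * geom p)); first ring.
by rewrite h1 mulr1.
Qed.

Lemma geom_ge p : (0 < N)%N -> (N <= p)%N -> geom p = 1.
Proof.
move=> N_gt0 p_ge; rewrite /geom (bigD1 (Ordinal N_gt0)) //= muln0 big1 ?addr0 //.
move=> i; rewrite -val_eqE /= -lt0n => i_gt0.
by apply: exprN_ge; apply: leq_trans p_ge _; apply: leq_pmulr.
Qed.

Definition distinct_odd_factor (p : nat) : A :=
  if p == 0%N then 1 else if odd p then 1 + x ^+ p else geom p.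

(** The product [D_k] of the overview. *)
Definition distinct_odd (k : nat) : A := \prod_(p < (2 * k)%N) distinct_odd_factor p.

Definition no2mod4_factor (p : nat) : A :=
  if (p == 0%N) || (p %% 4 == 2)%N then 1 else geom p.

Definition no2mod4 (k : nat) : A := \prod_(p < 4 * k) no2mod4_factor p.

(** The case [k = 0] is apart because the new even index [2 * k] is then 0, where [geom] has its
    junk value. *)
Lemma distinct_oddS k : distinct_odd k.+1 =
  distinct_odd k * (if k == 0%N then 1 else geom (2 * k)) * (1 + x ^+ (2 * k).+1).
Proof.
rewrite /distinct_odd mulnS !big_ord_recr /=.
congr (_ * _ * _); rewrite /distinct_odd_factor.
  by rewrite muln_eq0 /= oddM.
by rewrite /= oddM.
Qed.

Lemma sum_distinct_odd k :
  (1 + x ^+ 3) * \sum_(1 <= j < k.+2) x ^+ (2 * j) * distinct_odd j =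
  x ^+ 2 * distinct_odd k.+1 * (1 + x ^+ (2 * k).+3).
Proof.
elim: k => [|k IHk]; first by rewrite big_nat1 !muln0 muln1; ring.
rewrite big_nat_recr //= mulrDr IHk (distinct_oddS k.+1) /=.
set G := geom _; set D := distinct_odd _.
have hG : (1 - x ^+ (2 * k.+1)) * G = 1 by apply: geomK.
have -> : ((2 * k).+3 = 2 * k.+1 + 1)%N by lia.
have -> : ((2 * k.+1).+3 = 2 * k.+1 + 3)%N by lia.
have -> : ((2 * k.+1).+1 = 2 * k.+1 + 1)%N by lia.
have -> : (2 * k.+2 = 2 * k.+1 + 2)%N by lia.
rewrite !exprD expr1; set y := x ^+ (2 * k.+1) in hG *.
(* Inserting [(1 - y) * G = 1] gives both terms the common factor [x ^+ 2 * D * G * (1 + y * x)];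
   the cofactors add up to [(1 - y) + (1 + x ^+ 3) * y = 1 + x ^+ 3 * y]. *)
transitivity (x ^+ 2 * D * (1 + y * x) * ((1 - y) * G) +
    (1 + x ^+ 3) * (y * x ^+ 2 * (D * G * (1 + y * x)))); last by ring.
by rewrite hG mulr1.
Qed.


Definition geom2mod4 (k : nat) : A := \prod_(j < k) geom (4 * j + 2).

(* Both sides are multiplied by a geom2mod4 factor so that the identity holds
   exactly, for every k, without discarding high powers of x. *)
Lemma no2mod4_distinct_odd k :
  no2mod4 k * geom2mod4 k = distinct_odd (2 * k) * geom2mod4 (2 * k).
Proof.
elim: k => [|k IHk].
  by rewrite /no2mod4 /geom2mod4 /distinct_odd !big_ord0.
have -> : (2 * k.+1 = (2 * k).+2)%N by lia.
rewrite !distinct_oddS muln_eq0 /=.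
have -> : no2mod4 k.+1 = no2mod4 k * (if k == 0%N then 1 else geom (4 * k)) *
    geom (4 * k).+1 * geom (4 * k).+3.
  rewrite /no2mod4 mulnS !big_ord_recr /= /no2mod4_factor /= muln_eq0 /=.
  have -> : ((4 * k) %% 4 == 2)%N = false by lia.
  have -> : ((4 * k).+1 %% 4 == 2)%N = false by lia.
  have -> : ((4 * k).+2 %% 4 == 2)%N by lia.
  have -> : ((4 * k).+3 %% 4 == 2)%N = false by lia.
  by rewrite orbF mulr1.
have -> : geom2mod4 k.+1 = geom2mod4 k * geom (4 * k).+2.
  by rewrite /geom2mod4 big_ord_recr /= addn2.
have -> : geom2mod4 (2 * k).+2 =
    geom2mod4 (2 * k) * geom (2 * (4 * k).+1) * geom (2 * (4 * k).+3).
  rewrite /geom2mod4 !big_ord_recr /=; congr (_ * geom _ * geom _); lia.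
(* Doubling the two new odd indices gives [8 * k + 2] and [8 * k + 6], exactly the two new indices
   in [geom2mod4 (2 * k).+2]. *)
rewrite (geom_double (p := (4 * k).+1)) // (geom_double (p := (4 * k).+3)) //.
have -> : (2 * (2 * k) = 4 * k)%N by lia.
have -> : (2 * (2 * k).+1 = (4 * k).+2)%N by lia.
move: IHk; set a := no2mod4 k; set b := geom2mod4 k => IHk.
transitivity ((a * b) * (if k == 0%N then 1 else geom (4 * k)) *
  (1 + x ^+ (4 * k).+1) * (1 + x ^+ (4 * k).+3) * geom (4 * k).+2 *
  geom (2 * (4 * k).+1) * geom (2 * (4 * k).+3)); first by ring.
rewrite IHk; move: (x ^+ _) (x ^+ _) (if _ then _ else _) => y z w; ring.
Qed.

(** Once [N <= 4 * k], the factors of [geom2mod4 (2 * k)] beyond the first [k] are 1, so both sides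
    of the previous identity carry the same invertible factor, which cancels. *)
Lemma no2mod4_eq_distinct_odd k :
  (0 < N)%N -> (N <= 4 * k)%N -> no2mod4 k = distinct_odd (2 * k).
Proof.
move=> N_gt0 N_le.
have Q_unit : (\prod_(j < k) (1 - x ^+ (4 * j + 2))) * geom2mod4 k = 1.
  rewrite /geom2mod4 -big_split big1 //= => j _; apply: geomK; lia.
have Q2 : geom2mod4 (2 * k) = geom2mod4 k.
  rewrite /geom2mod4 mul2n -addnn big_split_ord /= [X in _ * X]big1 ?mulr1 //.
  by move=> j _; apply: geom_ge => //; lia.
have := no2mod4_distinct_odd k; rewrite Q2 => eqQ.
by rewrite -[LHS]mulr1 -[RHS]mulr1 -Q_unit [_ * geom2mod4 k]mulrC !mulrA eqQ.
Qed.

(** In the telescoped sum up to [j = 2 * k], the last term contains [x ^+ (4 * k)] and the final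
    factor is [1 + x ^+ (4 * k + 1)]; both powers vanish. *)
Lemma sum_distinct_odd_total k :
  (0 < k)%N -> (0 < N)%N -> (N <= 4 * k)%N ->
  (1 + x ^+ 3) * \sum_(1 <= j < 2 * k) x ^+ (2 * j) * distinct_odd j =
  x ^+ 2 * no2mod4 k.
Proof.
move=> k_gt0 N_gt0 N_le; rewrite no2mod4_eq_distinct_odd //.
have [k' def_k] : exists k', (2 * k = k'.+1)%N.
  by exists (2 * k).-1; rewrite prednK ?muln_gt0.
have := sum_distinct_odd k'; rewrite -def_k big_nat_recr /=; last lia.
rewrite [x ^+ (2 * (2 * k))]exprN_ge ?mul0r ?addr0; last lia.
by move->; rewrite [x ^+ (_).+3]exprN_ge ?addr0 ?mulr1 //; lia.
Qed.

End TruncatedSeries.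

(** * The constraints defining [c] and [o3] *)

Definition C_mult (p i : nat) : bool :=
  ((p == 0) || (p %% 4 == 2)) ==> (i == 0).

(** Fixing the largest part to be [2 * k] turns the conditions of [O3] into independent conditions
    on the multiplicities, as a product formula requires. *)
Definition O3_mult (k p i : nat) : bool :=
  if (p == 0) || (2 * k < p) then i == 0
  else if p == 2 * k then i == 1 else odd p ==> (i <= 1).

Lemma partition_le_largest (m p : nat) (s : seq nat) :
  is_partition m s -> p \in s -> p <= largest s.
Proof.
case/and3P=> + _ _; case: s => //= a s s_sorted; rewrite inE => /predU1P[-> //|].
have geq_trans : transitive geq by move=> y x z /= yx zy; exact: leq_trans yx.
by move/allP: (order_path_min geq_trans s_sorted); apply.
Qed.

Lemma respects_C (m N : nat) (s : seq nat) :
  is_partition m s -> m < N ->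
  respects C_mult N s = all (fun p => p != 2 %[mod 4]) s.
Proof.
move=> s_part m_lt; apply/forallP/allP => [s_mu p p_s | s_mod p].
  have p_lt := allP (partition_parts_lt s_part m_lt) _ p_s.
  apply/negP => p_mod; move: (s_mu (Ordinal p_lt)); rewrite /C_mult /=.
  move: p_mod; rewrite (modn_small (m := 2)) // => -> /=.
  rewrite orbT /= => /eqP /count_memPn.
  by rewrite p_s.
apply/implyP => /orP[/eqP-> | p_mod]; first by rewrite (partition_count0 s_part).
by apply/eqP/count_memPn/negP => /s_mod; rewrite p_mod.
Qed.

Lemma respects_O3 (m N k : nat) (s : seq nat) :
  is_partition m s -> m < N -> 0 < k -> 2 * k < N ->
  respects (O3_mult k) N s =
  [&& largest s == 2 * k, all (fun p => odd p ==> (count_mem p s <= 1)) s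
    & count_mem (largest s) s == 1].
Proof.
move=> s_part m_lt k_gt0 k_lt; have s_lt := allP (partition_parts_lt s_part m_lt).
have k2 : (2 * k == 0) || (2 * k < 2 * k) = false by lia.
apply/forallP/and3P => [s_mu | [/eqP s_max /allP s_odd s_max1] p].
  have k_count : count_mem (2 * k) s = 1.
    by move: (s_mu (Ordinal k_lt)); rewrite /O3_mult /= k2 eqxx => /eqP.
  have k_s : 2 * k \in s by apply/count_memPn; rewrite k_count.
  have s_le p : p \in s -> p <= 2 * k.
    move=> p_s; rewrite leqNgt; apply/negP => p_gt.
    move: (s_mu (Ordinal (s_lt _ p_s))).
    rewrite /O3_mult /= p_gt orbT => /eqP /count_memPn.
    by rewrite p_s.
  have s_max : largest s = 2 * k.
    apply/eqP; rewrite eqn_leq (partition_le_largest s_part k_s) andbT.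
    by apply: s_le; case: (s) k_s => //= a s' _; rewrite mem_head.
  rewrite s_max eqxx k_count; split=> //; apply/allP => p p_s; apply/implyP => p_odd.
  move: (s_mu (Ordinal (s_lt _ p_s))); rewrite /O3_mult /= p_odd ltnNge s_le //= orbF.
  by case: eqP p_odd => [-> //|_ p_odd]; case: eqP p_odd => [-> | //]; rewrite oddM.
rewrite /O3_mult; case: ifP => [/orP[/eqP-> | p_gt] | _].
- by rewrite (partition_count0 s_part).
- apply/eqP/count_memPn/negP => /(partition_le_largest s_part).
  by rewrite s_max leqNgt p_gt.
case: eqP => [-> | _]; first by rewrite -s_max.
have [p_s | /count_memPn->] := boolP (nat_of_ord p \in s); first exact: s_odd.
by rewrite implybT.
Qed.

Lemma c_respects (m N : nat) :
  m < N -> c m = #|[set l in partitions m | respects C_mult N (parts l)]|.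
Proof.
move=> m_lt; rewrite /c /C; apply: eq_card => l; rewrite !inE.
by apply: andb_id2l => l_part; rewrite (respects_C l_part m_lt).
Qed.

(** After exchanging the sums, each partition is treated alone: one in [O3] is counted only for [k]
    equal to half its largest part. *)
Lemma o3_respects (m K : nat) :
  m < 2 * K -> o3 m = \sum_(1 <= k < K)
    #|[set l in partitions m | respects (O3_mult k) (2 * K) (parts l)]|.
Proof.
move=> m_lt; rewrite /o3 -sum1_card big_mkcond /=.
under [RHS]eq_bigr do rewrite -sum1_card big_mkcond /=.
rewrite exchange_big /=; apply: eq_bigr => l _; rewrite !inE.
have [l_part /= | /negPf l_npart] := boolP (is_partition m (parts l)); last first.
  by rewrite big1 // => k _; rewrite !inE l_npart.
under [RHS]eq_big_nat => k /andP[k_gt0 k_lt].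
  rewrite !inE l_part (respects_O3 l_part m_lt) ?ltn_pmul2l //.
  over.
set a := all _ _; set s := parts l in l_part *; set b := count_mem _ _ == 1.
have [/= ab | /negPf ab] := boolP (a && b); last first.
  by rewrite big1 => [|k _]; rewrite ?ab ?andbF // andbAC ab.
have s_max : largest s \in s.
  by case/andP: ab => _ /eqP b1; apply/count_memPn; rewrite b1.
have [max_gt0 max_lt] : 0 < largest s /\ largest s < 2 * K.
  split; last exact: (allP (partition_parts_lt l_part m_lt)).
  by case/and3P: l_part => _ /allP/(_ _ s_max).
case/andP: ab => -> ->; rewrite andbT /=.
(* An even largest part selects a single summand; an odd one makes both sides 0. *)
case: ifPn => [max_even | max_odd].
  rewrite (bigD1_seq (largest s)./2) ?iota_uniq ?mem_index_iota //=; last by lia.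
  rewrite big1 => [|k k_neq]; last by case: (largest s =P _) => //=; lia.
  by case: (largest s =P _) => //=; lia.
by rewrite big1 // => k _; case: (largest s =P _) => //; lia.
Qed.

(** * Evaluating the products attached to the constraints *)

Section Factors.
Local Open Scope ring_scope.
Variables (A : comNzRingType) (x : A) (N : nat).
Hypothesis N_gt1 : (1 < N)%N.

Lemma sum_mult0 p : \sum_(i < N | i == 0%N :> nat) x ^+ (p * i) = 1.
Proof. by rewrite (big_pred1 (Ordinal (ltnW N_gt1))) ?muln0 // => i. Qed.
Lemma sum_mult1 p : \sum_(i < N | i == 1%N :> nat) x ^+ (p * i) = x ^+ p.
Proof. by rewrite (big_pred1 (Ordinal N_gt1)) ?muln1 // => i. Qed.

Lemma sum_mult_le1 p : \sum_(i < N | (i <= 1)%N) x ^+ (p * i) = 1 + x ^+ p.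
Proof.
rewrite (bigID (fun i : 'I_N => i == 0%N :> nat)) /=.
rewrite -(sum_mult0 p) -[in RHS](sum_mult1 p).
by congr (_ + _); apply: eq_bigl => i; lia.
Qed.

Lemma prod_C_mult k : N = (4 * k)%N ->
  \prod_(p < N) \sum_(i < N | C_mult p i) x ^+ (p * i) = no2mod4 x N k.
Proof.
move=> def_N; rewrite /no2mod4 -def_N; apply: eq_bigr => p _.
by rewrite /C_mult /no2mod4_factor; case: ifP => // _; exact: sum_mult0.
Qed.

(** Indices above [2 * k] contribute 1, the index [2 * k] contributes the power of [x], and the
    smaller ones form [D_k]. *)
Lemma prod_O3_mult k : (0 < k)%N -> (2 * k < N)%N ->
  \prod_(p < N) \sum_(i < N | O3_mult k p i) x ^+ (p * i) =
  x ^+ (2 * k) * distinct_odd x N k.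
Proof.
move=> k_gt0 k_lt.
rewrite -(big_mkord xpredT (fun p => \sum_(i < N | O3_mult k p i) x ^+ (p * i))).
rewrite (big_cat_nat _ k_lt) //= [X in _ * X]big1_seq ?mulr1; last first.
  move=> p; rewrite mem_index_iota /= => /andP[p_gt _].
  by rewrite /O3_mult p_gt orbT sum_mult0.
rewrite big_nat_recr //= mulrC; congr (_ * _).
  rewrite -[RHS]sum_mult1; apply: eq_bigl => i.
  by rewrite /O3_mult ltnn orbF muln_eq0 /= eqxx; case: (k) k_gt0.
rewrite /distinct_odd -(big_mkord xpredT (distinct_odd_factor x N)).
apply: eq_big_nat => p /= p_lt; rewrite /O3_mult /distinct_odd_factor.
rewrite ltnNge (ltnW p_lt) orbF (ltn_eqF p_lt).
case: eqP => _; first exact: sum_mult0.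
by case: (odd p) => //=; exact: sum_mult_le1.
Qed.
End Factors.

(** * Polynomials modulo a power of the indeterminate *)

Section TruncatedPoly.
Local Open Scope ring_scope.
Variables (R : comNzRingType) (N : nat).
Hypothesis N_gt0 : (0 < N)%N.

(** Reduction modulo ['X^N] is truncation, which keeps the coefficients below [N]. *)
Lemma in_qpolyXn_coef (p q : {poly R}) i :
  in_qpoly 'X^N p = in_qpoly 'X^N q -> (i < N)%N -> p`_i = q`_i.
Proof.
move=> /(congr1 val) /=; rewrite mk_monic_Xn prednK // => eq_pq i_lt.
rewrite -!Pdiv.RingMonic.take_poly_rmodp in eq_pq.
by move/(congr1 (fun r : {poly R} => r`_i)): eq_pq; rewrite !coef_take_poly i_lt.
Qed.

Lemma in_qpolyXn_nilp : (in_qpoly 'X^N 'X : {poly %/ ('X^N : {poly R})}) ^+ N = 0.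
Proof.
rewrite -rmorphXn; apply: val_inj => /=; rewrite mk_monic_Xn prednK //.
by rewrite -Pdiv.RingMonic.take_poly_rmodp -['X^N]mul1r take_polyMXn_0.
Qed.
End TruncatedPoly.

Theorem theorem3p2 (n : nat) (hn : 2 < n) :
  o3 (n + 2) + o3 (n - 1) = c n.
Proof.
(* [N] is both [4 * K], the range of [no2mod4 K], and [2 * (2 * K)], the form asked by
   [o3_respects]; [K] is large enough for [n + 2 < N]. *)
pose K := n.+3; pose N := 4 * K; pose A : comNzRingType := {poly %/ ('X^N : {poly int})}.
pose pi : {rmorphism {poly int} -> A} := in_qpoly 'X^N; pose x : A := pi 'X%R.
have xN : (x ^+ N = 0)%R by exact: in_qpolyXn_nilp.
pose series (mu : nat -> pred nat) : {poly int} :=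
  (\prod_(p < N) \sum_(i < N | mu p i) 'X^(p * i))%R.
have pi_series mu :
    (pi (series mu) = \prod_(p < N) \sum_(i < N | mu (p : nat) (i : nat)) x ^+ (p * i))%R.
  rewrite rmorph_prod; apply: eq_bigr => p _; rewrite rmorph_sum.
  by apply: eq_bigr => i _; rewrite rmorphXn.
pose O3_series := (\sum_(1 <= k < 2 * K) series (O3_mult k))%R.
have O3_coef m : m < N -> (O3_series`_m = (o3 m)%:R)%R.
  move=> m_lt; rewrite (o3_respects (K := 2 * K)) ?mulnA // natr_sum coef_sum.
  apply: eq_big_nat => k /andP[k_gt0 _].
  by rewrite coef_prod_multiplicities.
have C_coef m : m < N -> ((series C_mult)`_m = (c m)%:R)%R.
  by move=> m_lt; rewrite (c_respects m_lt) coef_prod_multiplicities.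
have key : (pi ((1 + 'X^3) * O3_series) = pi ('X^2 * series C_mult))%R.
  rewrite !rmorphM rmorphD rmorph1 !rmorphXn -/x.
  rewrite pi_series (prod_C_mult _ _ (k := K)) //.
  rewrite -sum_distinct_odd_total //; congr (_ * _)%R.
  rewrite rmorph_sum; apply: eq_big_nat => k /andP[k_gt0 k_lt].
  rewrite pi_series prod_O3_mult //; lia.
have N_gt0 : 0 < N by [].
have coef_lt : n + 2 < N by lia.
have := in_qpolyXn_coef N_gt0 key coef_lt.
(* At degree [n + 2], the factor [1 + 'X^3] yields the indices [n + 2] and [n - 1] for [o3], and
   ['X^2] yields [n] for [c]. *)
rewrite mulrDl mul1r coefD !coefXnM.
have -> : n + 2 < 3 = false by lia.
have -> : n + 2 < 2 = false by lia.
have -> : n + 2 - 3 = n - 1 by lia.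
rewrite addnK !O3_coef ?C_coef; lia.
Qed.
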